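(* For every $n\ge1$ and positive weights $a,b,c$, the dimer partition function of the Sierpiński graph $\Gamma_n$ with the ''Schreier'' labeling is $$\Phi_n(a,b,c)=\begin{cases}2\,(4abc)^{\frac{3^{n-1}-3}{4}}\,(abc+ab+ac+bc) & n \text{ even},\\ (4abc)^{\frac{3^{n-1}-1}{4}}\,(1+a+b+c) & n\text{ odd}.\end{cases}$$ Hence the number of dimer coverings of $\Gamma_n$ is $2^{\frac{3^{n-1}+3}{2}}$.
   Context: Let $a,b,c$ act on ternary words by the recursive rules, valid for any ternary word $w$: - $a(0w)=1w$, $a(1w)=0w$, $a(2w)=2a(w)$; - $b(0w)=2w$, $b(2w)=0w$, $b(1w)=1b(w)$; - $c(1w)=2w$, $c(2w)=1w$, $c(0w)=0c(w)$. These are the generators of the Hanoi Towers group. Let $\Sigma_n$ be the graph on $\{0,1,2\}^n$ with one edge labeled $s$ for each unordered pair $\{u,s(u)\}$, $s(u)\ne u$, $s\in\{a,b,c\}$; no loops are included. For each $w\in\{0,1,2\}^{n-1}$, the ''elementary triangle'' is formed by the vertices $0w,1w,2w$ and the edges $0w$–$1w$ (label $a$), $0w$–$2w$ (label $b$), and $1w$–$2w$ (label $c$). The Sierpiński graph $\Gamma_n$ with the ''Schreier'' labeling is obtained from $\Sigma_n$ by contracting every edge that does not belong to an elementary triangle; these edges form a matching. The remaining edges keep their labels. $\Gamma_n$ has $\frac32(3^{n-1}+1)$ vertices, and its three corners are the vertices $0^n,1^n,2^n$. A dimer covering of $\Gamma_n$ is a matching of $\Gamma_n$ covering every non-corner vertex,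 and - for $n$ odd, covering exactly zero or two corners; - for $n$ even, covering exactly one or three corners. With edges labeled $s$ given weight $s>0$, $\Phi_n(a,b,c)$ is the sum over dimer coverings of the product of the edge weights. *)

(* Defs.v *)
From HB Require Import structures.
From mathcomp Require Export all_boot all_order all_algebra.
Set Implicit Arguments.
Unset Strict Implicit.
Unset Printing Implicit Defensive.
Import Order.TTheory GRing.Theory Num.Theory.

Inductive label : predArgType := La | Lb | Lc.

Definition label_ord (s : label) : 'I_3 :=
  match s with
  | La => @Ordinal 3 0 isT
  | Lb => @Ordinal 3 1 isT
  | Lc => @Ordinal 3 2 isT
  end.

Definition ord_label (i : 'I_3) : label :=
  match val i with 0 => La | 1 => Lb | _ => Lc end.

Lemma label_ordK : cancel label_ord ord_label.
Proof. by case. Qed.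

HB.instance Definition _ := Finite.copy label (can_type label_ordK).

(* The first letter of a word is the head of the sequence. *)
Definition letter := 'I_3.
Definition d0 : letter := @Ordinal 3 0 isT.
Definition d1 : letter := @Ordinal 3 1 isT.
Definition d2 : letter := @Ordinal 3 2 isT.

Fixpoint act (s : label) (w : seq letter) : seq letter :=
  if w is x :: w' then
    match s, val x with
    | La, 0 => d1 :: w'
    | La, 1 => d0 :: w'
    | La, _ => d2 :: act La w'
    | Lb, 0 => d2 :: w'
    | Lb, 2 => d0 :: w'
    | Lb, _ => d1 :: act Lb w'
    | Lc, 1 => d2 :: w'
    | Lc, 2 => d1 :: w'
    | Lc, _ => d0 :: act Lc w'
    end
  else [::].

Lemma size_act s w : size (act s w) = size w.
Proof.
by elim: w s => //= -[[|[|[|k]]] // ?] w IHw [] /=; rewrite ?IHw.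
Qed.

Lemma act_tupleP n s (w : n.-tuple letter) : size (act s w) == n.
Proof. by rewrite size_act size_tuple. Qed.

Canonical act_tuple n s (w : n.-tuple letter) := Tuple (act_tupleP s w).

(* An edge is a label together with the set of its two endpoints. *)
Definition edge n : finType := (label * {set n.-tuple letter})%type.

Definition sigma_edges n : {set edge n} :=
  [set e : edge n | [exists u : n.-tuple letter,
     (act_tuple e.1 u != u) && (e.2 == [set u; act_tuple e.1 u])]].

(* Meaningful for n >= 1 only, since w below ranges over words of length
   n - 1. *)
Definition elementary n : {set edge n} :=
  [set e : edge n | [exists w : n.-1.-tuple letter,
     [|| e == (La, [set u : n.-tuple letter |
                      tval u \in [:: d0 :: w; d1 :: w]]),
         e == (Lb, [set u : n.-tuple letter |
                      tval u \in [:: d0 :: w; d2 :: w]])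
       | e == (Lc, [set u : n.-tuple letter |
                      tval u \in [:: d1 :: w; d2 :: w]])]]].

Definition contracted_edges n : {set edge n} := sigma_edges n :\: elementary n.

Definition contracted_rel n : rel (n.-tuple letter) :=
  [rel u v | [exists e in contracted_edges n, e.2 == [set u; v]]].

(* A vertex of the contracted graph is the set of vertices of the original
   graph that are identified by the contraction. *)
Definition gamma_vertex n (u : n.-tuple letter) : {set n.-tuple letter} :=
  [set v | connect (@contracted_rel n) u v].

Definition gamma_vertices n : {set {set n.-tuple letter}} :=
  [set gamma_vertex u | u : n.-tuple letter].

Definition gamma_edges n : {set edge n} :=
  sigma_edges n :\: contracted_edges n.

(* The endpoints of an edge of the contracted graph are the classes of its
   endpoints in the original graph. *)
Definition endpoints n (e : edge n) : {set {set n.-tuple letter}} :=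
  [set gamma_vertex u | u in e.2].

Definition corners n : {set {set n.-tuple letter}} :=
  [set gamma_vertex [tuple of nseq n x] | x : letter].

Definition matching n (M : {set edge n}) : bool :=
  (M \subset gamma_edges n) &&
  [forall e in M, forall f in M,
     (e != f) ==> [disjoint endpoints e & endpoints f]].

Definition covered n (M : {set edge n}) : {set {set n.-tuple letter}} :=
  \bigcup_(e in M) endpoints e.

Definition dimer_covering n (M : {set edge n}) : bool :=
  [&& matching M,
      gamma_vertices n :\: corners n \subset covered M
    & #|corners n :&: covered M| \in
        (if odd n then [:: 0; 2] else [:: 1; 3])].

Local Open Scope ring_scope.

Definition weight (R : nzRingType) (a b c : R) (s : label) : R :=
  match s with La => a | Lb => b | Lc => c end.

Definition Phi (R : comNzRingType) (n : nat) (a b c : R) : R :=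
  \sum_(M : {set edge n} | dimer_covering M)
    \prod_(e in M) weight a b c e.1.

Local Close Scope ring_scope.

(* The exponents 3 ^ n.-1 - 3, 3 ^ n.-1 - 1 and 3 ^ n.-1 + 3 are divided
   exactly and without truncation. *)
Lemma exponent_even n : 0 < n -> ~~ odd n ->
  (3 <= 3 ^ n.-1) && (4 %| 3 ^ n.-1 - 3).
Proof.
case: n => //= n _; rewrite negbK => on.
have n0 : 0 < n by case: n on.
have le3 : 3 <= 3 ^ n by rewrite -{1}(expn1 3) leq_pexp2l.
rewrite le3 -eqn_mod_dvd //= -(odd_double_half n) on add1n expnS -mul2n expnM.
by rewrite -modnMmr -modnXm exp1n.
Qed.

Lemma exponent_odd n : odd n -> 4 %| 3 ^ n.-1 - 1.
Proof.
case: n => //= n en; rewrite -eqn_mod_dvd ?expn_gt0 //.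
by rewrite -(odd_double_half n) (negbTE en) -mul2n expnM -modnXm exp1n.
Qed.

Lemma exponent_count n : 2 %| 3 ^ n.-1 + 3.
Proof. by rewrite dvdn2 oddD oddX orbT. Qed.

(* Main.v *)
(* Every elementary triangle contains at most one edge of a matching of
   Gamma_(m+1), so a set of edges with this property is a map g from words of
   length m to {none, a, b, c}.  The contracted edge at the vertex xw joins xw
   to x s(w), where s is the generator fixing the letter x; it exists unless
   w = x^m.  Hence g is a dimer covering iff exactly one of the two ends of every
   contracted edge is covered; the condition on the corners is then automatic,
   by parity.  Splitting words according to their last letter cuts g into three
   configurations of level m - 1, glued along three contracted edges.  The
   partition function of coverings with prescribed status of the corners
   therefore satisfies a cubic recursion, under which two profiles alternate:
   (1, a, b, c) at even m and (abc, ab, ac, bc) at odd m, up to a scalar. *)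

Require Import Defs.
From mathcomp Require Import all_boot all_order all_algebra ring zify.
Set Implicit Arguments.
Unset Strict Implicit.
Unset Printing Implicit Defensive.
Import GRing.Theory Num.Theory.

(** * Letters and the action of the generators on words *)

Lemma letterP (x : letter) : [\/ x = d0, x = d1 | x = d2].
Proof.
case: x => [[|[|[|k]]] //] lt_x3.
- by constructor 1; apply: val_inj.
- by constructor 2; apply: val_inj.
- by constructor 3; apply: val_inj.
Qed.

Lemma all_letter (P : pred letter) :
  [forall x, P x] = [&& P d0, P d1 & P d2].
Proof.
apply/forallP/and3P => [allP | [P0 P1 P2] x]; first by split.
by case: (letterP x) => ->.
Qed.

Lemma big_letter (T : Type) (idx : T) (op : Monoid.law idx) (F : letter -> T) :
  \big[op/idx]_x F x = op (F d0) (op (F d1) (F d2)).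
Proof.
rewrite !big_ord_recl big_ord0 Monoid.mulm1.
by congr (op (F _) (op (F _) (F _))); apply: val_inj.
Qed.

Definition fixed_letter (s : label) : letter :=
  match s with La => d2 | Lb => d1 | Lc => d0 end.

Definition fixing_label (x : letter) : label :=
  match val x with 0 => Lc | 1 => Lb | _ => La end.

(** The permutation of the letters induced by [s], read off from one-letter words. As [act]
    preserves the length, the default of [head] is never returned. *)
Definition act_letter (s : label) (x : letter) : letter := head x (act s [:: x]).

Lemma fixed_letterK : cancel fixed_letter fixing_label.
Proof. by case. Qed.

Lemma fixing_labelK : cancel fixing_label fixed_letter.
Proof. by move=> x; case: (letterP x) => ->. Qed.

Lemma act_cons s x w :
  act s (x :: w) =
    if x == fixed_letter s then x :: act s w else act_letter s x :: w.
Proof. by case: s; case: (letterP x) => ->. Qed.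

Lemma act_letter_neq s x :
  x != fixed_letter s ->
  (act_letter s x != x) && (act_letter s x != fixed_letter s).
Proof. by case: s; case: (letterP x) => ->. Qed.

Lemma exists_moved s : exists x, x != fixed_letter s.
Proof. by exists (if s is Lc then d1 else d0); case: s. Qed.

(** Each generator fixes one letter only, so a third letter is moved by both: two edges of one
    triangle always share a vertex. *)
Lemma exists_moved2 s t :
  exists x, (x != fixed_letter s) && (x != fixed_letter t).
Proof.
by case: s; case: t;
  first [exists d0; by [] | exists d1; by [] | exists d2; by []].
Qed.

Lemma letter_cases s x y : x != fixed_letter s ->
  (y != fixed_letter s) = (y == x) || (y == act_letter s x).
Proof. by case: s; case: (letterP x) => ->; case: (letterP y) => ->. Qed.

Lemma actK s : involutive (act s).
Proof.
by elim=> // x w IHw; case: s IHw; case: (letterP x) => -> /= IHw //; rewrite IHw.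
Qed.

Lemma act_fixed s w : (act s w == w) = (w == nseq (size w) (fixed_letter s)).
Proof.
elim: w => // x w IHw; rewrite act_cons /= [RHS]eqseq_cons.
case: ifP => [/eqP-> | /negbT x_moved]; first by rewrite eqseq_cons IHw eqxx.
by have /andP[/negbTE neq_sx _] := act_letter_neq x_moved; rewrite eqseq_cons neq_sx.
Qed.

(** A generator passes over its fixed letter and stops at the first other one, so it reaches the
    last letter only when the prefix is constant. *)
Lemma act_rcons s w y :
  act s (rcons w y) =
    if w == nseq (size w) (fixed_letter s) then rcons w (act_letter s y)
    else rcons (act s w) y.
Proof.
elim: w => [|x w IHw]; first by case: s; case: (letterP y) => ->.
rewrite rcons_cons !act_cons /= eqseq_cons IHw.
by case: (x == _) => //=; case: ifP.
Qed.

(** * Words *)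

Section Words.
Variable m : nat.
Implicit Types (w : m.-tuple letter) (u v : m.+1.-tuple letter).

Definition corner x : m.-tuple letter := [tuple of nseq m x].

Definition partner x w : m.-tuple letter := act_tuple (fixing_label x) w.

Lemma partnerK x : involutive (partner x).
Proof. by move=> w; apply/val_inj/actK. Qed.

Lemma partner_fixed x w : (partner x w == w) = (w == corner x).
Proof. by rewrite -!val_eqE /= act_fixed fixing_labelK size_tuple. Qed.

Lemma partner_corner x : partner x (corner x) = corner x.
Proof. by apply/eqP; rewrite partner_fixed. Qed.

Definition word_cons x w : m.+1.-tuple letter := [tuple of x :: w].

Definition word_rcons w x : m.+1.-tuple letter := [tuple of rcons w x].

Lemma word_consP u : exists x w, u = word_cons x w.
Proof. by case/tupleP: u => x w; exists x, w; apply: val_inj. Qed.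

Lemma eq_word_cons x y w w' :
  (word_cons x w == word_cons y w') = (x == y) && (w == w').
Proof. by rewrite -val_eqE /= eqseq_cons. Qed.

Definition word_last u : letter := last (thead u) (behead u).

Definition word_belast u : m.-tuple letter :=
  [tuple of belast (thead u) (behead_tuple u)].

Lemma word_rconsE u : u = word_rcons (word_belast u) (word_last u).
Proof. by apply: val_inj; rewrite /= -lastI {1}(tuple_eta u). Qed.

Lemma word_rconsK w x :
  (word_belast (word_rcons w x) = w) * (word_last (word_rcons w x) = x).
Proof.
have /(congr1 val)/= := word_rconsE (word_rcons w x).
by case/rcons_inj=> eq_w eq_x; split; [apply: val_inj|].
Qed.

Lemma word_rcons_bij : bijective (fun p => word_rcons p.1 p.2).
Proof.
exists (fun u => (word_belast u, word_last u)) => [[w x] | u] /=.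
  by rewrite !word_rconsK.
by rewrite -word_rconsE.
Qed.

Lemma eq_word_rcons x y w w' :
  (word_rcons w x == word_rcons w' y) = (w == w') && (x == y).
Proof. by rewrite -val_eqE /= eqseq_rcons. Qed.

End Words.

Lemma corner_rcons m x : corner m.+1 x = word_rcons (corner m x) x.
Proof. by apply: val_inj; elim: m => //= k {1}->. Qed.

(** This is the self-similarity of the graph: the contracted edges at level [m.+1] are those of the
    three copies indexed by the last letter [y], and for each [x] one new edge linking the corners
    [x] of the two copies with [y] different from [x]. *)
Lemma partner_rcons m x (w : m.-tuple letter) y :
  partner x (word_rcons w y) =
    if w == corner m x then word_rcons w (act_letter (fixing_label x) y)
    else word_rcons (partner x w) y.
Proof.
apply: val_inj; rewrite /= act_rcons fixing_labelK size_tuple -val_eqE /=.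
by case: ifP.
Qed.

(** * Configurations and gluing *)

Definition cfg m : finType := {ffun m.-tuple letter -> option label}.

Definition covers (o : option label) (x : letter) : bool :=
  if o is Some s then x != fixed_letter s else false.

Definition valid m (g : cfg m) : bool :=
  [forall x, forall w, (w != corner m x) ==>
     (covers (g w) x != covers (g (partner x w)) x)].

Definition corner_covered m (g : cfg m) x : bool := covers (g (corner m x)) x.

Definition sel (T : Type) (p : T * T * T) (y : letter) : T :=
  match val y with 0 => p.1.1 | 1 => p.1.2 | _ => p.2 end.

Definition glue m (p : cfg m * cfg m * cfg m) : cfg m.+1 :=
  [ffun u => sel p (word_last u) (word_belast u)].

Lemma glueE m (p : cfg m * cfg m * cfg m) w y :
  glue p (word_rcons w y) = sel p y w.
Proof. by rewrite ffunE !word_rconsK. Qed.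

Lemma glue_bij m : bijective (@glue m).
Proof.
pose cut y (g : cfg m.+1) : cfg m := [ffun w => g (word_rcons w y)].
exists (fun g => (cut d0 g, cut d1 g, cut d2 g)) => [[[g0 g1] g2] | g].
  by congr (_, _, _); apply/ffunP=> w; rewrite ffunE glueE.
apply/ffunP=> u; rewrite (word_rconsE u) glueE.
by case: (letterP (word_last u)) => ->; rewrite /= ffunE.
Qed.

Lemma corner_covered_glue m (p : cfg m * cfg m * cfg m) x :
  corner_covered (glue p) x = corner_covered (sel p x) x.
Proof. by rewrite /corner_covered corner_rcons glueE. Qed.

Lemma valid_glue m (g0 g1 g2 : cfg m) :
  valid (glue (g0, g1, g2)) =
    [&& valid g0, valid g1, valid g2,
        corner_covered g1 d0 != corner_covered g2 d0,
        corner_covered g0 d1 != corner_covered g2 d1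
      & corner_covered g0 d2 != corner_covered g1 d2].
Proof.
pose p := (g0, g1, g2).
suff ->: valid (glue p) = [forall y, valid (sel p y)] &&
    [forall x, forall y, (y != x) ==> (corner_covered (sel p y) x !=
       corner_covered (sel p (act_letter (fixing_label x) y)) x)].
  rewrite !all_letter /= /act_letter /= [sel p d0]/= [sel p d1]/= [sel p d2]/=.
  rewrite -!andbA; do 3!congr (_ && _).
  (* Each linking edge occurs twice, once from either end; symmetry of the equality merges the
     duplicates. *)
  rewrite ![corner_covered g2 _ == _]eq_sym [corner_covered g1 d2 == _]eq_sym.
  by do 3!case: (_ == _).
apply/idP/andP => [vg | [/forallP vp /forallP glued]].
  split.
    apply/forallP=> y; apply/forallP=> x; apply/forallP=> w; apply/implyP=> ncw.
    move/forallP/(_ x)/forallP/(_ (word_rcons w y))/implyP: vg.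
    rewrite partner_rcons (negbTE ncw) !glueE corner_rcons eq_word_rcons.
    by rewrite (negbTE ncw); apply.
  apply/forallP=> x; apply/forallP=> y; apply/implyP=> neq_yx.
  move/forallP/(_ x)/forallP/(_ (word_rcons (corner m x) y))/implyP: vg.
  rewrite partner_rcons eqxx !glueE corner_rcons eq_word_rcons eqxx.
  by apply.
apply/forallP=> x; apply/forallP=> u; apply/implyP.
rewrite (word_rconsE u); move: (word_belast u) (word_last u) => w y.
rewrite corner_rcons eq_word_rcons partner_rcons !glueE.
case: eqP => [-> neq_yx | /eqP ncw _]; rewrite glueE.
  by have /forallP/(_ y)/implyP := glued x; apply.
by have /forallP/(_ x)/forallP/(_ w)/implyP := vp y; apply.
Qed.

(** In a single triangle an edge covers two corners and no edge covers none. In the inductive step,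
    six of the nine corners of the copies are glued in three pairs with one covered member each, so
    the parity becomes that of three times [m] minus 3, which is that of [m.+1]. *)
Lemma valid_parity m (g : cfg m) : valid g ->
  corner_covered g d0 (+) corner_covered g d1 (+) corner_covered g d2 = odd m.
Proof.
elim: m g => [|m IHm] g.
  rewrite /corner_covered !(tuple0 (corner 0 _)) => _.
  by case: (g _) => [[]|].
have [cut _ cutK] := glue_bij m.
rewrite -(cutK g); case: (cut g) => [[g0 g1] g2].
rewrite valid_glue !corner_covered_glue /= => /and4P[/IHm p0 /IHm p1 /IHm p2].
rewrite -[sel _ d0]/g0 -[sel _ d1]/g1 -[sel _ d2]/g2.
move: p0 p1 p2; case: (odd m);
by do 3!case: (corner_covered g0 _); do 3!case: (corner_covered g1 _);
   do 3!case: (corner_covered g2 _).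
Qed.

(** * Partition functions with prescribed corners *)

Section Sums.
Local Open Scope ring_scope.
Variables (R : comNzRingType) (a b c : R).

Definition opt_weight (o : option label) : R :=
  if o is Some s then weight a b c s else 1.

Definition cfg_weight m (g : cfg m) : R := \prod_w opt_weight (g w).

Definition corner_sum m (t0 t1 t2 : bool) : R :=
  \sum_(g : cfg m | valid g && [&& corner_covered g d0 == t0,
      corner_covered g d1 == t1 & corner_covered g d2 == t2]) cfg_weight g.

Lemma cfg_weight_glue m (g0 g1 g2 : cfg m) :
  cfg_weight (glue (g0, g1, g2)) = cfg_weight g0 * cfg_weight g1 * cfg_weight g2.
Proof.
rewrite /cfg_weight (reindex _ (onW_bij _ (word_rcons_bij m))) /=.
under eq_bigr do rewrite glueE.
rewrite -(pair_bigA _ (fun w y => opt_weight (sel (g0, g1, g2) y w))) exchange_big /=.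
by rewrite big_letter /= mulrA.
Qed.

Lemma big_bool3 (F : bool * bool * bool -> R) :
  \sum_d F d = \sum_(d0 : bool) \sum_(d1 : bool) \sum_(d2 : bool) F (d0, d1, d2).
Proof.
rewrite pair_bigA (pair_bigA _ (fun p d2 => F (p.1, p.2, d2))).
by apply: eq_bigr => -[[]].
Qed.

Lemma sum_triple (T : finType) (P0 P1 P2 : pred T) (F : T -> R) :
  \sum_(p : T * T * T | [&& P0 p.1.1, P1 p.1.2 & P2 p.2])
     F p.1.1 * F p.1.2 * F p.2 =
  (\sum_(g | P0 g) F g) * (\sum_(g | P1 g) F g) * (\sum_(g | P2 g) F g).
Proof.
rewrite [X in X * _]big_distrlr pair_big /= big_distrlr pair_big /=.
by apply: eq_bigl => p; rewrite andbA.
Qed.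

(** One Boolean per linking edge suffices, since the status of one end is the negation of that of
    the other: [e0] belongs to corner 0 of copy 1, [e1] and [e2] to corners 1 and 2 of copy 0. *)
Lemma corner_sum_rec m t0 t1 t2 :
  corner_sum m.+1 t0 t1 t2 =
    \sum_(e0 : bool) \sum_(e1 : bool) \sum_(e2 : bool)
      corner_sum m t0 e1 e2 * corner_sum m e0 t1 (~~ e2) * corner_sum m (~~ e0) (~~ e1) t2.
Proof.
rewrite /corner_sum (reindex _ (onW_bij _ (glue_bij m))) /=.
rewrite (partition_big (fun p => (corner_covered p.1.2 d0,
   corner_covered p.1.1 d1, corner_covered p.1.1 d2)) predT) //= big_bool3.
apply: eq_bigr => e0 _; apply: eq_bigr => e1 _; apply: eq_bigr => e2 _.
rewrite -sum_triple; apply: eq_big => [[[g0 g1] g2] | [[g0 g1] g2] _] /=.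
  rewrite valid_glue !corner_covered_glue.
  rewrite -[sel _ d0]/g0 -[sel _ d1]/g1 -[sel _ d2]/g2 !xpair_eqE.
  case: (valid g0); case: (valid g1); case: (valid g2); rewrite /= ?andbF //.
  case: (_ == t0); case: (_ == t1); case: (_ == t2);
    rewrite /= ?andbF // {t0 t1 t2}.
  by move: e0 e1 e2; do 2!case: (corner_covered g0 _);
     do 2!case: (corner_covered g1 _); do 2!case: (corner_covered g2 _);
     do 3!case.
by rewrite cfg_weight_glue.
Qed.

Lemma sum_valid m :
  \sum_(g : cfg m | valid g) cfg_weight g =
    \sum_(t0 : bool) \sum_(t1 : bool) \sum_(t2 : bool) corner_sum m t0 t1 t2.
Proof.
rewrite (partition_big (fun g => (corner_covered g d0, corner_covered g d1,
  corner_covered g d2)) predT) //= big_bool3.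
apply: eq_bigr => t0 _; apply: eq_bigr => t1 _; apply: eq_bigr => t2 _.
by rewrite /corner_sum; apply: eq_bigl => g; rewrite !xpair_eqE -[in LHS]andbA.
Qed.

(** The partition function of a single triangle: two covered corners determine the edge. *)
Definition even_profile (t0 t1 t2 : bool) : R :=
  match t0, t1, t2 with
  | false, false, false => 1
  | true, true, false => a
  | true, false, true => b
  | false, true, true => c
  | _, _, _ => 0
  end.

(** Where it is nonzero, this is [a * b * c] divided by the value of [even_profile] at the
    complementary statuses. *)
Definition odd_profile (t0 t1 t2 : bool) : R :=
  match t0, t1, t2 with
  | true, true, true => a * b * c
  | true, false, false => a * b
  | false, true, false => a * c
  | false, false, true => b * c
  | _, _, _ => 0
  end.

(** Parity in each copy forces an odd number of covered outer corners and then leaves two of the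
    eight choices of [e0], [e1], [e2]. Both have the same weight, whence the factor 2; the odd step
    works likewise. *)
Lemma corner_sum_even_step m k :
  (forall t0 t1 t2, corner_sum m t0 t1 t2 = k * even_profile t0 t1 t2) ->
  forall t0 t1 t2, corner_sum m.+1 t0 t1 t2 = 2 * k ^+ 3 * odd_profile t0 t1 t2.
Proof.
move=> sum_m t0 t1 t2; rewrite corner_sum_rec !big_bool /= !sum_m.
by case: t0; case: t1; case: t2 => /=; ring.
Qed.

Lemma corner_sum_odd_step m k :
  (forall t0 t1 t2, corner_sum m t0 t1 t2 = k * odd_profile t0 t1 t2) ->
  forall t0 t1 t2, corner_sum m.+1 t0 t1 t2 =
    2 * k ^+ 3 * (a * b * c) ^+ 2 * even_profile t0 t1 t2.
Proof.
move=> sum_m t0 t1 t2; rewrite corner_sum_rec !big_bool /= !sum_m.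
by case: t0; case: t1; case: t2 => /=; ring.
Qed.

Lemma corner_sum0 t0 t1 t2 : corner_sum 0 t0 t1 t2 = even_profile t0 t1 t2.
Proof.
pose cst (o : option label) : cfg 0 := [ffun=> o].
have cst_bij : bijective cst.
  exists (fun g : cfg 0 => g [tuple]) => [o | g]; first by rewrite ffunE.
  by apply/ffunP=> w; rewrite ffunE (tuple0 w).
rewrite /corner_sum (reindex _ (onW_bij _ cst_bij)) big_mkcond /=.
have valid_cst o : valid (cst o).
  (* The empty word is a corner for every letter, so validity is vacuous. *)
  by apply/forallP=> x; apply/forallP=> w; rewrite (tuple0 w) (tuple0 (corner _ _)).
under eq_bigr => o _.
  rewrite valid_cst /corner_covered /cfg_weight !ffunE.
  rewrite (big_pred1 [tuple]); last by move=> w; rewrite (tuple0 w) /= eqxx.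
  rewrite ffunE.
  over.
rewrite (bigD1 None) // (bigD1 (Some La)) // (bigD1 (Some Lb)) //.
rewrite (bigD1 (Some Lc)) //= big1 => [|[[]|] //].
by case: t0; case: t1; case: t2; rewrite /= ?add0r ?addr0.
Qed.

(** The equation for [e] replaces the quotient by 4, so that no truncated subtraction enters the
    induction. *)
Lemma corner_sum_even k : exists e, (3 ^ k.*2 = 4 * e + 1)%N /\
  forall t0 t1 t2, corner_sum k.*2 t0 t1 t2 = (4 * a * b * c) ^+ e * even_profile t0 t1 t2.
Proof.
elim: k => [|k [e [eq_e IHk]]].
  by exists 0%N; split=> // t0 t1 t2; rewrite corner_sum0 mul1r.
(* An even step followed by an odd one turns a scalar K into 2(2K^3)^3(abc)^2 = K^9(4abc)^2. *)
exists (9 * e + 2)%N; split; first by rewrite doubleS !expnS eq_e; lia.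
move=> t0 t1 t2; rewrite doubleS (corner_sum_odd_step (corner_sum_even_step IHk)).
by rewrite exprD mulnC exprM; ring.
Qed.

Lemma sum_valid_formula m :
  \sum_(g : cfg m | valid g) cfg_weight g =
    if odd m then 2 * (4 * a * b * c) ^+ ((3 ^ m - 3) %/ 4)
                    * (a * b * c + a * b + a * c + b * c)
    else (4 * a * b * c) ^+ ((3 ^ m - 1) %/ 4) * (1 + a + b + c).
Proof.
rewrite sum_valid -(odd_double_half m); have [e [eq_e Ze]] := corner_sum_even m./2.
rewrite oddD odd_double addbF; case: (odd m) => /=; rewrite ?add0n ?add1n.
  have -> : ((3 ^ m./2.*2.+1 - 3) %/ 4 = e * 3)%N by rewrite expnS eq_e; lia.
  by rewrite !big_bool /= !(corner_sum_even_step Ze) exprM /=; ring.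
have -> : ((3 ^ m./2.*2 - 1) %/ 4 = e)%N by rewrite eq_e; lia.
by rewrite !big_bool /= !Ze /=; ring.
Qed.

End Sums.

(** * Matchings of the contracted graph *)

Section Graph.
Variable m : nat.
Implicit Types (w : m.-tuple letter) (u v : m.+1.-tuple letter).
Implicit Types (g : cfg m) (M : {set edge m.+1}).

(** A uniform form of the three edges of the triangle over [w]: the label [s] joins the two vertices
    whose first letter is moved by [s]. *)
Definition tri_edge (s : label) w : edge m.+1 :=
  (s, [set u : m.+1.-tuple letter |
         (thead u != fixed_letter s) && (behead_tuple u == w :> seq letter)]).

Lemma mem_tri_edge s w x w' :
  (word_cons x w' \in (tri_edge s w).2) = (x != fixed_letter s) && (w' == w).
Proof. by rewrite inE theadE /= val_eqE. Qed.

Lemma tri_edge_inj s s' w w' : tri_edge s w = tri_edge s' w' -> s = s' /\ w = w'.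
Proof.
move=> eq_e; have eq_s : s = s' := congr1 fst eq_e; split=> //.
have [x neq_x] := exists_moved s.
have := mem_tri_edge s' w' x w; rewrite -eq_e mem_tri_edge neq_x eqxx -eq_s neq_x.
by move/esym/eqP.
Qed.

Lemma elementaryP (e : edge m.+1) :
  reflect (exists s w, e = tri_edge s w) (e \in elementary m.+1).
Proof.
have eq_tri s w y z : (forall x, (x != fixed_letter s) = (x \in [:: y; z])) ->
    (s, [set u : m.+1.-tuple letter | tval u \in [:: y :: w; z :: w]]) =
    tri_edge s w.
  move=> mem_yz; congr (_, _); apply/setP=> u; have [x [w' ->]] := word_consP u.
  rewrite !inE theadE mem_yz !inE /= !eqseq_cons -andb_orl.
  by congr (_ && _).
rewrite inE; apply: (iffP existsP) => [[w] | [s [w ->]]].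
  by case/or3P=> /eqP->; [exists La, w | exists Lb, w | exists Lc, w];
     apply: eq_tri => x; case: (letterP x) => ->.
exists w; case: s; apply/or3P;
  [constructor 1 | constructor 2 | constructor 3]; apply/eqP/esym/eq_tri => x;
  by case: (letterP x) => ->.
Qed.

Lemma act_word_cons s x w :
  act_tuple s (word_cons x w) =
    if x == fixed_letter s then word_cons x (partner x w)
    else word_cons (act_letter s x) w.
Proof.
apply: val_inj; apply: etrans (act_cons s x w) _; case: eqP => //= ->.
by rewrite fixed_letterK.
Qed.

Lemma tri_edge_act s x w : x != fixed_letter s ->
  tri_edge s w = (s, [set word_cons x w; act_tuple s (word_cons x w)]).
Proof.
move=> neq_x; congr (_, _); apply/setP=> u; have [y [w' ->]] := word_consP u.
rewrite inE theadE /= act_word_cons (negbTE neq_x) !inE !eq_word_cons -andb_orl.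
by rewrite -letter_cases.
Qed.

Lemma elementary_sub_sigma : elementary m.+1 \subset sigma_edges m.+1.
Proof.
apply/subsetP=> _ /elementaryP[s [w ->]]; rewrite inE; apply/existsP.
have [x neq_x] := exists_moved s.
exists (word_cons x w); rewrite (tri_edge_act _ neq_x) eqxx andbT /=.
rewrite act_word_cons (negbTE neq_x) eq_word_cons eqxx andbT.
by case/andP: (act_letter_neq neq_x).
Qed.

Lemma gamma_edges_elementary : gamma_edges m.+1 = elementary m.+1.
Proof.
rewrite /gamma_edges /contracted_edges setDDr setDv set0U.
exact/setIidPr/elementary_sub_sigma.
Qed.

(* The other end of the contracted edge at u, or u itself at a corner. *)
Definition opposite u : m.+1.-tuple letter :=
  word_cons (thead u) (partner (thead u) (behead_tuple u)).

Lemma opposite_cons x w : opposite (word_cons x w) = word_cons x (partner x w).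
Proof.
rewrite /opposite theadE; congr (word_cons _ (partner _ _)); exact: val_inj.
Qed.

Lemma oppositeK : involutive opposite.
Proof. by move=> u; have [x [w ->]] := word_consP u; rewrite !opposite_cons partnerK. Qed.

(** An edge labeled [s] at [xw] stays in the triangle over [w] if [s] moves [x], and leads to the
    opposite vertex if [s] fixes [x]. Only edges of the second kind are contracted. *)
Lemma contracted_relE u v :
  contracted_rel u v = (opposite u != u) && (v == opposite u).
Proof.
apply/exists_inP/andP=> [[[s E] /setDP[]] | [neq_u /eqP->]].
  rewrite inE => /existsP[t /= /andP[neq_t /eqP eqE]]; rewrite {}eqE {E}.
  have [x [w eq_t]] := word_consP t.
  have [eq_x | neq_x] := eqVneq x (fixed_letter s); last first.
    by case/negP; apply/elementaryP; exists s, w; rewrite eq_t (tri_edge_act _ neq_x).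
  have act_t : act_tuple s t = opposite t.
    by rewrite eq_t act_word_cons eq_x eqxx opposite_cons.
  rewrite act_t in neq_t * => _ /eqP eq_uv.
  have: u \in [set t; opposite t] by rewrite eq_uv set21.
  have: v \in [set t; opposite t] by rewrite eq_uv set22.
  have: t \in [set u; v] by rewrite -eq_uv set21.
  have: opposite t \in [set u; v] by rewrite -eq_uv set22.
  (* Of the four ways to match the two pairs, those with [u] equal to [v] contradict [neq_t]. *)
  rewrite !inE => ot tt /orP[]/eqP ev /orP[]/eqP eu; subst u v.
  - by rewrite !orbb (negbTE neq_t) in ot.
  - by rewrite oppositeK eqxx eq_sym.
  - by rewrite eqxx.
  by rewrite !orbb eq_sym (negbTE neq_t) in tt.
have [x [w eq_u]] := word_consP u.
exists (fixing_label x, [set u; opposite u]) => //; apply/setDP; split.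
  rewrite inE; apply/existsP; exists u => /=.
  suff ->: act_tuple (fixing_label x) u = opposite u by rewrite neq_u eqxx.
  by rewrite eq_u act_word_cons fixing_labelK eqxx opposite_cons.
apply/elementaryP=> -[s [w' eq_e]].
have eq_s : fixing_label x = s := congr1 fst eq_e.
have /(congr1 (fun e : edge m.+1 => u \in e.2)) := eq_e.
by rewrite set21 eq_u mem_tri_edge -eq_s fixing_labelK eqxx.
Qed.

(** As [opposite] is an involution, the pair formed by [u] and its opposite is closed under the
    contracted relation, hence is a whole class. *)
Lemma mem_gamma_vertex u v :
  (v \in gamma_vertex u) = (v == u) || (v == opposite u).
Proof.
rewrite inE; apply/idP/orP=> [|[]/eqP->]; last first.
- have [-> | neq_u] := eqVneq (opposite u) u; first exact: connect0.
  by apply: connect1; rewrite contracted_relE neq_u eqxx.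
- exact: connect0.
have closed_pair : closed (@contracted_rel m.+1)
    [pred v | (v == u) || (v == opposite u)].
  move=> s t; rewrite contracted_relE => /andP[_ /eqP->]; rewrite !inE.
  by rewrite (inj_eq (inv_inj oppositeK)) (can2_eq oppositeK oppositeK) orbC.
by move/(closed_connect closed_pair); rewrite !inE eqxx => /esym/orP.
Qed.

Lemma eq_gamma_vertex u v :
  (gamma_vertex u == gamma_vertex v) = (v == u) || (v == opposite u).
Proof.
apply/eqP/idP=> [eq_uv | /orP[]/eqP-> //].
  by rewrite -mem_gamma_vertex eq_uv mem_gamma_vertex eqxx.
by apply/setP=> t; rewrite !mem_gamma_vertex oppositeK orbC.
Qed.

(** A vertex of the contracted graph named by a representative; away from the corners it has two
    names, with [w] and with [partner x w]. *)
Definition cell x w : {set m.+1.-tuple letter} := gamma_vertex (word_cons x w).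

Lemma eq_cell x y w w' :
  (cell x w == cell y w') = (y == x) && ((w' == w) || (w' == partner x w)).
Proof. by rewrite eq_gamma_vertex opposite_cons !eq_word_cons -andb_orr. Qed.

Lemma endpoints_tri_edge s w x w' :
  (cell x w' \in endpoints (tri_edge s w)) =
    (x != fixed_letter s) && ((w == w') || (w == partner x w')).
Proof.
apply/imsetP/andP=> [[u] | [neq_x /orP[]/eqP->]].
- have [y [w1 ->]] := word_consP u; rewrite mem_tri_edge => /andP[neq_y /eqP->] /eqP.
  by rewrite eq_cell => /andP[/eqP eq_yx ->]; rewrite -eq_yx.
- by exists (word_cons x w') => //; rewrite mem_tri_edge neq_x eqxx.
exists (word_cons x (partner x w')); first by rewrite mem_tri_edge neq_x eqxx.
by apply/eqP; rewrite eq_cell !eqxx orbT.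
Qed.

Lemma endpointsP (E : {set m.+1.-tuple letter}) s w :
  E \in endpoints (tri_edge s w) -> exists x, E = cell x w.
Proof.
case/imsetP=> u; have [x [w' ->]] := word_consP u.
by rewrite mem_tri_edge => /andP[_ /eqP->] ->; exists x.
Qed.

(** * Configurations as sets of edges *)

Definition edges_of_cfg g : {set edge m.+1} :=
  [set tri_edge p.1 p.2 | p : label * m.-tuple letter & g p.2 == Some p.1].

(** The choice made by [pick] is unambiguous when [M] is a matching, which has at most one edge in
    each triangle. *)
Definition cfg_of_edges M : cfg m :=
  [ffun w => [pick s | tri_edge s w \in M]].

Lemma mem_edges_of_cfg g s w :
  (tri_edge s w \in edges_of_cfg g) = (g w == Some s).
Proof.
apply/imsetP/idP=> [[[s' w']] | gw]; last by exists (s, w); rewrite ?inE.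
by rewrite inE /= => gw /tri_edge_inj[-> ->].
Qed.

Lemma edges_of_cfgK : cancel edges_of_cfg cfg_of_edges.
Proof.
move=> g; apply/ffunP=> w; rewrite ffunE; case: pickP => [s | none].
  by rewrite mem_edges_of_cfg => /eqP.
by case gw: (g w) => [s|] //; have := none s; rewrite mem_edges_of_cfg gw eqxx.
Qed.

Lemma cfg_of_edgesK M : matching M -> edges_of_cfg (cfg_of_edges M) = M.
Proof.
case/andP; rewrite gamma_edges_elementary => sub_M /forall_inP disj_M.
apply/setP=> e; apply/idP/idP => [/imsetP[[s w]] | Me].
  by rewrite inE /= ffunE; case: pickP => //= s' Ms' /eqP[<-] ->.
have /elementaryP[s [w eq_e]] := subsetP sub_M e Me; rewrite eq_e in Me *.
rewrite mem_edges_of_cfg ffunE; case: pickP => [s' Ms' | /(_ s)]; last by rewrite Me.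
apply/eqP; congr Some; apply/eqP; apply/contraT=> neq_s.
have neq_e : tri_edge s w != tri_edge s' w.
  by apply/eqP=> /tri_edge_inj[eq_s]; rewrite eq_s eqxx in neq_s.
have /forall_inP/(_ _ Ms')/implyP/(_ neq_e) := disj_M _ Me.
(* A letter moved by both labels gives a common endpoint of two distinct edges of the matching. *)
have [x /andP[xs xs']] := exists_moved2 s s'.
move/pred0P/(_ (cell x w)); rewrite /= !endpoints_tri_edge.
by rewrite xs xs' eqxx.
Qed.

Lemma covered_cfg g x w :
  (cell x w \in covered (edges_of_cfg g)) =
    covers (g w) x || covers (g (partner x w)) x.
Proof.
apply/bigcupP/orP => [[e] | ].
  case/imsetP=> -[s w']; rewrite inE /= => /eqP gw -> .
  rewrite endpoints_tri_edge => /andP[neq_x /orP[]/eqP eq_w].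
    by left; rewrite -eq_w gw.
  by right; rewrite -eq_w gw.
have cov w' : covers (g w') x ->
    exists2 s, tri_edge s w' \in edges_of_cfg g & x != fixed_letter s.
  by case gw: (g w') => [s|] //= neq_x; exists s; rewrite // mem_edges_of_cfg gw.
by case=> /cov[s gs neq_x]; [exists (tri_edge s w) | exists (tri_edge s (partner x w))];
  rewrite // endpoints_tri_edge neq_x eqxx ?orbT.
Qed.

(** Edges over distinct words can meet only in a vertex made by contraction. Corners are exempt:
    there [partner x w] is [w], and the condition would forbid covering them. *)
Lemma matching_cfg g :
  matching (edges_of_cfg g) =
    [forall x, forall w, (w != corner m x) ==>
       ~~ (covers (g w) x && covers (g (partner x w)) x)].
Proof.
apply/andP/forallP=> [[_ /forall_inP disj] x | vg].
  apply/forallP=> w; apply/implyP=> ncw; apply/negP.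
  case gw: (g w) => [s|] //=;
    case gw': (g _) => [s'|]; rewrite ?andbF //= => /andP[xs xs'].
  have Ms : tri_edge s w \in edges_of_cfg g by rewrite mem_edges_of_cfg gw.
  have Ms' : tri_edge s' (partner x w) \in edges_of_cfg g.
    by rewrite mem_edges_of_cfg gw'.
  have neq_e : tri_edge s w != tri_edge s' (partner x w).
    by apply/eqP=> /tri_edge_inj[_ /eqP]; rewrite eq_sym partner_fixed (negbTE ncw).
  have /forall_inP/(_ _ Ms')/implyP/(_ neq_e)/pred0P/(_ (cell x w)) := disj _ Ms.
  by rewrite /= !endpoints_tri_edge xs xs' !eqxx orbT.
split.
  rewrite gamma_edges_elementary; apply/subsetP=> _ /imsetP[[s w] _ ->].
  by apply/elementaryP; exists s, w.
apply/forall_inP=> _ /imsetP[[s w] gs ->].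
apply/forall_inP=> _ /imsetP[[s' w'] gs' ->].
rewrite !inE /= in gs gs' *; apply/implyP=> neq_e; apply/pred0P=> E /=; apply/negP.
case/andP=> Es Es'; have [x eqE] := endpointsP Es.
rewrite {}eqE {E} !endpoints_tri_edge eqxx /= andbT in Es Es'.
case/andP: Es' => xs' /orP[] /eqP eq_w; rewrite {w'}eq_w in gs' neq_e.
  by move: gs neq_e; rewrite (eqP gs') => /eqP[->]; rewrite eqxx.
have /forallP/(_ w)/implyP := vg x; rewrite -partner_fixed (eqP gs) (eqP gs') /= Es xs'.
(* At a corner both edges lie in the same triangle, where [g] selects only one, so they coincide. *)
have [eq_w _ | _] := eqVneq (partner x w) w; last by move/(_ isT).
rewrite eq_w in gs' neq_e.
by move: gs neq_e; rewrite (eqP gs') => /eqP[->]; rewrite eqxx.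
Qed.

Lemma corner_cell x : gamma_vertex [tuple of nseq m.+1 x] = cell x (corner m x).
Proof. by congr gamma_vertex; apply: val_inj. Qed.

Lemma mem_corners x w : (cell x w \in corners m.+1) = (w == corner m x).
Proof.
apply/imsetP/eqP=> [[y _ /eqP] | ->]; last by exists x => //; rewrite corner_cell.
rewrite corner_cell eq_cell => /andP[/eqP-> /orP[/eqP-> // | /eqP eq_w]].
by rewrite -[w](partnerK x) -eq_w partner_corner.
Qed.

Lemma corners_covered g :
  #|corners m.+1 :&: covered (edges_of_cfg g)| =
    corner_covered g d0 + (corner_covered g d1 + corner_covered g d2).
Proof.
have -> : corners m.+1 :&: covered (edges_of_cfg g) =
    [set cell x (corner m x) | x in [pred x | corner_covered g x]].
  apply/setP=> E; rewrite inE; apply/andP/imsetP=> [[] | [x gx ->]].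
    case/imsetP=> x _ ->; rewrite corner_cell.
    by rewrite covered_cfg partner_corner orbb => gx; exists x.
  by rewrite mem_corners eqxx covered_cfg partner_corner orbb.
rewrite card_imset => [|x y /eqP]; last by rewrite eq_cell => /andP[/eqP->].
by rewrite -sum1_card big_mkcond big_letter /= !inE; do 3!case: (corner_covered g _).
Qed.

(** Being a matching says that at most one end of each contracted edge is covered, covering the
    non-corner vertices that at least one is; together they give [valid]. *)
Lemma dimer_covering_cfg g : dimer_covering (edges_of_cfg g) = valid g.
Proof.
have validE : valid g = matching (edges_of_cfg g) &&
    (gamma_vertices m.+1 :\: corners m.+1 \subset covered (edges_of_cfg g)).
  rewrite matching_cfg; apply/forallP/andP=> [vg | [/forallP vg /subsetP cov_g] x].
    split.
      apply/forallP=> x; apply/forallP=> w; apply/implyP=> ncw.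
      have /forallP/(_ w)/implyP/(_ ncw) := vg x.
      by case: covers; case: covers.
    apply/subsetP=> E /setDP[/imsetP[u _ ->]]; have [x [w ->]] := word_consP u.
    rewrite -/(cell x w) mem_corners covered_cfg => ncw.
    have /forallP/(_ w)/implyP/(_ ncw) := vg x.
    by case: covers; case: covers.
  apply/forallP=> w; apply/implyP=> ncw.
  have /forallP/(_ w)/implyP/(_ ncw) := vg x.
  have: cell x w \in covered (edges_of_cfg g).
    by apply: cov_g; apply/setDP; split; [apply: imset_f | rewrite mem_corners].
  by rewrite covered_cfg; case: covers; case: covers.
rewrite /dimer_covering andbA -validE; case vg: (valid g) => //=.
(* The number of covered corners is at most three and has the parity of [m], which is the condition
   imposed for [m.+1]. *)
rewrite corners_covered; move: (valid_parity vg); case: (odd m) => /=;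
by do 3!case: (corner_covered g _).
Qed.

End Graph.

(** * The partition function and the number of dimer coverings *)

Section Partition.
Local Open Scope ring_scope.
Variable R : comNzRingType.

Lemma weight_edges_of_cfg m (a b c : R) (g : cfg m) :
  \prod_(e in edges_of_cfg g) weight a b c e.1 = cfg_weight a b c g.
Proof.
rewrite big_imset /=; last by move=> [s w] [s' w'] _ _ /= /tri_edge_inj[-> ->].
rewrite (reindex (fun p : m.-tuple letter * label => (p.2, p.1))) /=; last first.
  by exists (fun p => (p.2, p.1)) => -[].
under eq_bigl do rewrite inE /=.
(* Grouping by triangles leaves at most one factor over each word; an empty product matches the
   weight 1 of [None]. *)
rewrite -(pair_big_dep xpredT (fun w s => g w == Some s) (fun _ s => weight a b c s)).
apply: eq_bigr => w _; case: (g w) => [s|]; last by rewrite big_pred0.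
by rewrite (big_pred1 s) // => s'; rewrite eq_sym.
Qed.

Lemma Phi_cfg m (a b c : R) :
  Phi m.+1 a b c = \sum_(g : cfg m | valid g) cfg_weight a b c g.
Proof.
rewrite /Phi (reindex_onto (@edges_of_cfg m) (@cfg_of_edges m)) /=; last first.
  by move=> M /and3P[/cfg_of_edgesK].
apply: eq_big => [g | g _]; last exact: weight_edges_of_cfg.
by rewrite dimer_covering_cfg edges_of_cfgK eqxx andbT.
Qed.

Lemma Phi_formula m (a b c : R) :
  Phi m.+1 a b c =
    if odd m.+1 then (4 * a * b * c) ^+ ((3 ^ m - 1) %/ 4) * (1 + a + b + c)
    else 2 * (4 * a * b * c) ^+ ((3 ^ m - 3) %/ 4)
           * (a * b * c + a * b + a * c + b * c).
Proof. by rewrite Phi_cfg sum_valid_formula /=; case: (odd m). Qed.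

End Partition.

Lemma card_dimer_covering m :
  #|[set M : {set edge m.+1} | dimer_covering M]| = 2 ^ ((3 ^ m + 3) %/ 2).
Proof.
apply/eqP; rewrite -(eqr_nat int).
have -> : (#|[set M : {set edge m.+1} | dimer_covering M]|%:R =
    Phi m.+1 1 1 1 :> int)%R.
  rewrite /Phi -sum1_card natr_sum; apply: eq_big => [M | M _]; first by rewrite inE.
  by rewrite big1 // => -[[]].
rewrite Phi_formula !mulr1 [odd _]/= natrX.
have := @exponent_odd m.+1; have := @exponent_even m.+1 isT.
case: ifP => /= odd_m.
  move=> _ /(_ odd_m) /divnK; set e := (_ %/ 4)%N => eq_e.
  (* Here 3^m = 4e + 1, and the value to match is 4^e times 4. *)
  have -> : ((3 ^ m + 3) %/ 2 = e * 2 + 2)%N by have := expn_gt0 3 m; lia.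
  by rewrite exprD mulnC exprM (_ : 2 ^+ 2 = 4)%R //; ring.
move=> /(_ (negbT odd_m))/andP[ge3 /divnK]; set e := (_ %/ 4)%N => eq_e _.
(* Here 3^m = 4e + 3, and the value to match is 2 times 4^e times 4. *)
have -> : ((3 ^ m + 3) %/ 2 = (1 + e * 2) + 2)%N by lia.
by rewrite !exprD mulnC exprM (_ : 2 ^+ 2 = 4)%R //; ring.
Qed.

Local Open Scope ring_scope.

Theorem theorem4p1 (R : realFieldType) (n : nat) (hn : (0 < n)%N) :
  (forall a b c : R, 0 < a -> 0 < b -> 0 < c ->
     Phi n a b c =
       if odd n
       then (4 * a * b * c) ^+ ((3 ^ n.-1 - 1) %/ 4) * (1 + a + b + c)
       else 2 * (4 * a * b * c) ^+ ((3 ^ n.-1 - 3) %/ 4)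
              * (a * b * c + a * b + a * c + b * c))
  /\ #|[set M : {set edge n} | dimer_covering M]|
       = (2 ^ ((3 ^ n.-1 + 3) %/ 2))%N.
Proof.
case: n hn => // m _; split=> [a b c _ _ _|]; first exact: Phi_formula.
exact: card_dimer_covering.
Qed.
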